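(* Let $m\ge 2$ and $n\ge 1$ be integers, let $G$ be an $(m-1)$-torsion free group, and let $R=\bigoplus_{g\in G}R_g$ be a $G$-graded ring such that $m-1\in U(R)$. Then $R$ is a graded $m$-nil clean ring if and only if the triangular matrix ring $T_n(R)(\overline{\sigma})$ is a graded $m$-nil clean ring for every $\overline{\sigma}\in G^n$.
   Context: Rings are associative with identity; $U(R)$ is the group of units of $R$. A ring $R$ is $G$-graded ($G$ a group with identity $e$) if $R=\bigoplus_{g\in G}R_g$ with additive subgroups satisfying $R_gR_h\subseteq R_{gh}$; elements of $\bigcup_g R_g$ are homogeneous. For $\overline{\sigma}=(g_1,\dots,g_n)\in G^n$, $T_n(R)(\overline{\sigma})$ denotes the ring of $n\times n$ upper triangular matrices over $R$ with the $G$-grading whose component of degree $\lambda\in G$ consists of the upper triangular matrices $(a_{ij})$ with $a_{ij}\in R_{g_i\lambda g_j^{-1}}$ for all $i,j$. An element $f$ is $m$-potent if $f^m=f$. A $G$-graded ring is graded $m$-nil clean if every homogeneous element is the sum of a homogeneous $m$-potent and a homogeneous nilpotent. A group $G$ is $k$-torsion free if $g^k=e$ implies $g=e$ for every $g\in G$. *)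

(* Defs.v *)
From HB Require Import structures.
From mathcomp Require Import all_boot all_algebra.

Set Implicit Arguments.
Unset Strict Implicit.
Unset Printing Implicit Defensive.

Import GRing.Theory.
Local Open Scope ring_scope.

Definition torsion_free (k : nat) (G : groupType) : Prop :=
  forall g : G, (g ^+ k = 1)%g -> g = 1%g.

(* GRing.unit is not available here: unitRingType excludes the zero ring and
   requires decidable invertibility. *)
Definition in_units (R : pzRingType) (x : R) : Prop :=
  exists y : R, y * x = 1 /\ x * y = 1.

(* The group may be infinite, so that the direct sum decomposition is expressed
   with finitely supported sums, indexed by duplicate-free sequences. *)
Record grading (G : groupType) (R : pzRingType) := Grading {
  gcomp :> G -> R -> Prop;
  gcomp0 : forall g, gcomp g 0;
  gcompB : forall g x y, gcomp g x -> gcomp g y -> gcomp g (x - y);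
  gcompM : forall g h x y, gcomp g x -> gcomp h y -> gcomp (g * h)%g (x * y);
  gcomp_span : forall x, exists (s : seq G) (f : G -> R),
    [/\ uniq s, forall g, gcomp g (f g) & x = \sum_(g <- s) f g];
  gcomp_indep : forall (s : seq G) (f : G -> R),
    uniq s -> (forall g, gcomp g (f g)) -> \sum_(g <- s) f g = 0 ->
    forall g, g \in s -> f g = 0
}.

Definition homogeneous (G : groupType) (R : pzRingType) (C : grading G R)
  (x : R) : Prop := exists g, C g x.

Definition potent (R : pzRingType) (m : nat) (x : R) : Prop := x ^+ m = x.

Definition nilpotent_elt (R : pzRingType) (x : R) : Prop :=
  exists k : nat, x ^+ k = 0.

Definition graded_nil_clean (m : nat) (G : groupType) (R : pzRingType)
  (C : grading G R) : Prop :=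
  forall x : R, homogeneous C x ->
  exists f b : R, [/\ homogeneous C f, potent m f,
                      homogeneous C b, nilpotent_elt b & x = f + b].

Section UpperTriangular.
Variables (R : pzRingType) (n : nat).

(* is_trig_mx means lower triangular *)
Definition upper_trig : {pred 'M[R]_n} := fun A =>
  [forall i : 'I_n, forall j : 'I_n, (j < i)%N ==> (A i j == 0)].

Lemma upper_trigP (A : 'M[R]_n) :
  reflect (forall i j : 'I_n, (j < i)%N -> A i j = 0) (A \in upper_trig).
Proof.
apply: (iffP forallP) => [H i j lt_ji | H i].
  by have /forallP/(_ j)/implyP/(_ lt_ji)/eqP := H i.
by apply/forallP=> j; apply/implyP=> /H->.
Qed.

Lemma upper_trig_subring : subring_closed upper_trig.
Proof.
split=> [|A B /upper_trigP HA /upper_trigP HB|A B /upper_trigP HA /upper_trigP HB];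
  apply/upper_trigP=> i j lt_ji.
- by rewrite mxE; case: eqP lt_ji => // ->; rewrite ltnn.
- by rewrite !mxE HA // HB // subr0.
- rewrite mxE big1 // => k _; case: (ltnP k i) => [/HA-> | le_ik].
    by rewrite mul0r.
  by rewrite HB ?mulr0 // (leq_trans lt_ji).
Qed.

Record upper_mx := UpperMx { umx :> 'M[R]_n; _ : umx \in upper_trig }.

HB.instance Definition _ := [isSub for umx].
HB.instance Definition _ := [Choice of upper_mx by <:].
HB.instance Definition _ :=
  GRing.SubChoice_isSubPzRing.Build 'M[R]_n upper_trig upper_mx
    upper_trig_subring.

End UpperTriangular.

Section GradingFacts.
Variables (G : groupType) (R : pzRingType) (C : grading G R).

Lemma gcompD g x y : C g x -> C g y -> C g (x + y).
Proof.
move=> Cx Cy; rewrite -[y]opprK; apply: gcompB Cx _.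
by rewrite -sub0r; apply: gcompB Cy; apply: gcomp0.
Qed.

Lemma gcomp_span0 x : exists sf : seq G * (G -> R),
  [/\ uniq sf.1, forall g, C g (sf.2 g), forall g, g \notin sf.1 -> sf.2 g = 0
    & x = \sum_(g <- sf.1) sf.2 g].
Proof.
have [s [f [us Cf ->]]] := gcomp_span C x.
exists (s, fun g => if g \in s then f g else 0); split=> //=.
- by move=> g; case: ifP => _ //; apply: gcomp0.
- by move=> g /negPf->.
- by rewrite big_seq [RHS]big_seq; apply: eq_bigr => g ->.
Qed.

Lemma sum_widen (s S : seq G) (f : G -> R) :
  uniq s -> uniq S -> {subset s <= S} -> (forall g, g \notin s -> f g = 0) ->
  \sum_(g <- S) f g = \sum_(g <- s) f g.
Proof.
move=> us uS sub f0; rewrite (bigID [in s]) /= [X in _ + X]big1 // addr0.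
rewrite -big_filter; apply: perm_big; apply: uniq_perm; rewrite ?filter_uniq //.
by move=> g; rewrite mem_filter; case: (boolP (g \in s)) => //= /sub.
Qed.

End GradingFacts.

Section TriangularGrading.
Variables (G : groupType) (R : pzRingType) (C : grading G R).
Variables (n : nat) (sigma : 'I_n -> G).

Definition tri_comp (l : G) (A : upper_mx R n) : Prop :=
  forall i j : 'I_n, C (sigma i * l * (sigma j)^-1)%g (A i j).

Lemma tri_comp0 l : tri_comp l 0.
Proof. by move=> i j; rewrite mxE; apply: gcomp0. Qed.

Lemma tri_compB l A B : tri_comp l A -> tri_comp l B -> tri_comp l (A - B).
Proof. by move=> CA CB i j; rewrite !mxE; apply: gcompB. Qed.

Lemma tri_compM l k A B :
  tri_comp l A -> tri_comp k B -> tri_comp (l * k)%g (A * B).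
Proof.
move=> CA CB i j; rewrite mxE.
apply: (@big_ind _ (C _)) => [|x y|h _]; [exact: gcomp0 | exact: gcompD |].
have := gcompM (CA i h) (CB h j).
by rewrite !mulgA mulgVK.
Qed.

Lemma umx_sum (s : seq G) (F : G -> upper_mx R n) i j :
  umx (\sum_(g <- s) F g) i j = \sum_(g <- s) F g i j.
Proof.
by elim: s => [|g s IH]; rewrite ?big_nil ?mxE // !big_cons mxE IH.
Qed.

Lemma shift_inj i j : injective (fun l : G => (sigma i * l * (sigma j)^-1)%g).
Proof. by move=> x y /mulIg /mulgI. Qed.

Lemma tri_comp_span A : exists (s : seq G) (F : G -> upper_mx R n),
  [/\ uniq s, forall l, tri_comp l (F l) & A = \sum_(l <- s) F l].
Proof.
have [D HD] := fin_all_exists (fun ij : 'I_n * 'I_n =>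
  gcomp_span0 C (A ij.1 ij.2)).
pose sh (ij : 'I_n * 'I_n) l := (sigma ij.1 * l * (sigma ij.2)^-1)%g.
pose us (ij : 'I_n * 'I_n) l := ((sigma ij.1)^-1 * l * sigma ij.2)%g.
pose S := undup (flatten [seq [seq us ij g | g <- (D ij).1] | ij : 'I_n * 'I_n]).
pose M l : 'M[R]_n :=
  \matrix_(i, j) if (i <= j)%N then (D (i, j)).2 (sh (i, j) l) else 0.
have Mu l : M l \in @upper_trig R n.
  by apply/upper_trigP=> i j lt_ji; rewrite mxE leqNgt lt_ji.
exists S, (fun l => UpperMx (Mu l)); split; first exact: undup_uniq.
  move=> l i j /=; rewrite mxE; case: ifP => _; last exact: gcomp0.
  by have [_ /(_ (sh (i, j) l))] := HD (i, j).
apply: val_inj; apply/matrixP=> i j; rewrite umx_sum /=.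
case: (leqP i j) => [le_ij | lt_ji]; last first.
  have /upper_trigP-> // := valP A.
  by rewrite big1 // => l _; rewrite mxE leqNgt lt_ji.
have [uD _ D0 ->] := HD (i, j).
transitivity (\sum_(l <- S) (D (i, j)).2 (sh (i, j) l)); last first.
  by apply: eq_bigr => l _; rewrite mxE le_ij.
rewrite -(big_map (sh (i, j)) xpredT (D (i, j)).2) (@sum_widen _ _ (D (i, j)).1) //.
  by rewrite map_inj_uniq ?undup_uniq //; apply: shift_inj.
move=> g gD; apply/mapP; exists (us (i, j) g); last first.
  by rewrite /sh /us !mulgA mulgV mul1g mulgK.
rewrite mem_undup; apply/flattenP; exists [seq us (i, j) g | g <- (D (i, j)).1].
  by apply/mapP; exists (i, j); rewrite ?mem_enum.
exact: map_f.
Qed.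

Lemma tri_comp_indep (s : seq G) (F : G -> upper_mx R n) :
  uniq s -> (forall l, tri_comp l (F l)) -> \sum_(l <- s) F l = 0 ->
  forall l, l \in s -> F l = 0.
Proof.
move=> us CF F0 l ls; apply: val_inj; apply/matrixP=> i j; rewrite /= mxE.
pose sh l := (sigma i * l * (sigma j)^-1)%g.
pose us' l := ((sigma i)^-1 * l * sigma j)%g.
have shK : cancel sh us' by move=> x; rewrite /sh /us' !mulgA mulVg mul1g mulgVK.
have usK : cancel us' sh by move=> x; rewrite /sh /us' !mulgA mulgV mul1g mulgK.
have := @gcomp_indep _ _ C (map sh s) (fun g => F (us' g) i j).
rewrite map_inj_uniq; last exact: shift_inj.
move=> /(_ us) H; rewrite -[l in F l]shK; apply: H; last exact: map_f.
- by move=> g; have := CF (us' g) i j; rewrite -/(sh _) usK.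
- rewrite big_map; under eq_bigr do rewrite shK.
  by rewrite -umx_sum F0 mxE.
Qed.

Definition tri_grading : grading G (upper_mx R n) :=
  Grading tri_comp0 tri_compB tri_compM tri_comp_span tri_comp_indep.

End TriangularGrading.

(* Main.v *)
Require Import Defs.
From mathcomp Require Import all_boot all_algebra.
Local Open Scope ring_scope.

Set Implicit Arguments.
Unset Strict Implicit.
Unset Printing Implicit Defensive.

(** Everything is read off the diagonal.  On upper triangular matrices the
    map from A to its entry at (i, i) is multiplicative, so the diagonal of a
    power of A consists of the powers of the diagonal entries, and A is
    nilpotent as soon as its diagonal entries are: some power of A is strictly
    upper triangular ([upper_nilpotent]).

    If the triangular ring is graded nil clean for the constant family
    sigma = 1, an element x of degree g is the corner entry of a matrix of
    degree g; the corner entries of a decomposition of that matrix decompose x.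

    Conversely, let A have degree l.  Its i-th diagonal entry is homogeneous,
    hence a sum f_i + b_i.  The matrix diag(f_i) is potent, and A - diag(f_i)
    is nilpotent, its diagonal entries being the b_i.  What has to be ensured
    is that diag(f_i) is homogeneous of degree l, that is, that f_i can be
    chosen in the same component as the entry of A which it approximates.
    This is [graded_nil_clean_same_degree], and it follows from the directness
    of the grading: if f_i lies in another component, comparing components
    shows that A i i is already nilpotent, and f_i may be replaced by 0. *)

Import GRing.Theory.

(** Comparing the components of degree [g] on both sides of [x = y + z]: [y]
    contributes nothing, and [z] contributes all of itself or nothing. *)
Lemma gcomp_addE (G : groupType) (R : pzRingType) (C : grading G R)
    (g h k : G) (x y z : R) :
  C g x -> C h y -> C k z -> h != g -> x = y + z -> x = 0 \/ x = z.
Proof.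
move=> Cx Cy Cz neq_hg def_x.
pose at_deg d u (l : G) : R := if l == d then u else 0.
have at_degP d u l : C d u -> C l (at_deg d u l).
  by rewrite /at_deg => Cu; case: eqP => [-> //|_]; apply: gcomp0.
have sum_at_deg s d u : uniq s -> d \in s -> \sum_(l <- s) at_deg d u l = u.
  by move=> us ds; rewrite -big_mkcond -big_filter filter_pred1_uniq // big_seq1.
pose s := undup [:: g; h; k].
have us : uniq s := undup_uniq _.
have [gs hs ks] : [/\ g \in s, h \in s & k \in s].
  by rewrite !mem_undup !inE !eqxx !orbT.
pose p l := at_deg g x l - at_deg h y l - at_deg k z l.
have Cp l : C l (p l) by do 2?apply: gcompB; apply: at_degP.
have sum_p : \sum_(l <- s) p l = 0.
  by rewrite !sumrB !sum_at_deg // def_x [y + z]addrC addrK subrr.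
have := gcomp_indep us Cp sum_p gs.
rewrite /p /at_deg eqxx eq_sym (negPf neq_hg) subr0.
by case: eqP => _ /eqP; rewrite ?subr0 ?subr_eq0 => /eqP; [right | left].
Qed.

(** The summands of a clean decomposition are homogeneous of a priori unrelated
    degrees; the potent one can always be moved to the degree of [x]. *)
Lemma graded_nil_clean_same_degree (m : nat) (G : groupType) (R : pzRingType)
    (C : grading G R) (g : G) (x : R) :
  (0 < m)%N -> graded_nil_clean m C -> C g x ->
  exists f : R, [/\ C g f, potent m f & nilpotent_elt (x - f)].
Proof.
move=> m_gt0 cleanC Cx.
have [|f [b [[h Cf] potf [k Cb] nilb def_x]]] := cleanC x; first by exists g.
have [eq_hg | neq_hg] := eqVneq h g.
  by exists f; rewrite -eq_hg def_x [f + b]addrC addrK.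
exists 0; rewrite subr0; split; first exact: gcomp0.
  by rewrite /potent expr0n gtn_eqF.
by case: (gcomp_addE Cx Cf Cb neq_hg def_x) => -> //; exists 1; rewrite expr1.
Qed.

Lemma upper_diagX (R : pzRingType) (n : nat) (A : upper_mx R n) (k : nat)
    (i : 'I_n) :
  (A ^+ k) i i = A i i ^+ k.
Proof.
elim: k => [|k IHk]; first by rewrite !expr0 mxE eqxx.
rewrite !exprS -IHk mxE (bigD1 i) //= big1 ?addr0 // => j neq_ji.
have [lt_ji | lt_ij | /val_inj eq_ij] := ltngtP j i.
- by rewrite (upper_trigP _ (valP A)) // mul0r.
- by rewrite (upper_trigP _ (valP (A ^+ k))) // mulr0.
- by rewrite eq_ij eqxx in neq_ji.
Qed.

(** Each factor of a strictly upper triangular matrix moves the support one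
    more step above the diagonal. *)
Lemma strict_upperX (R : pzRingType) (n : nat) (A : upper_mx R n) (k : nat)
    (i j : 'I_n) :
  (forall i : 'I_n, A i i = 0) -> (j < i + k)%N -> (A ^+ k) i j = 0.
Proof.
move=> A0; elim: k i j => [|k IHk] i j lt_j.
  by rewrite (upper_trigP _ (valP (A ^+ 0))) // -[X in (_ < X)%N]addn0.
rewrite exprS mxE big1 // => h _.
have [lt_hi | lt_ih | /val_inj->] := ltngtP h i.
- by rewrite (upper_trigP _ (valP A)) // mul0r.
- by rewrite IHk ?mulr0 // (leq_trans lt_j) // addnS -addSn leq_add2r.
- by rewrite A0 mul0r.
Qed.

Lemma upper_nilpotent (R : pzRingType) (n : nat) (A : upper_mx R n) :
  (forall i : 'I_n, nilpotent_elt (A i i)) -> nilpotent_elt A.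
Proof.
move=> /fin_all_exists[k Ak].
(* The sum of the exponents k i is a common exponent for all diagonal entries;
   the n-th power of a strictly upper triangular matrix of size n vanishes. *)
exists (\sum_i k i * n)%N; rewrite -big_distrl exprM /=.
apply: val_inj; apply/matrixP=> i j; rewrite [RHS]mxE.
apply: strict_upperX => [l|]; last by rewrite ltn_addl.
by rewrite upper_diagX (bigD1 l) //= exprD Ak mul0r.
Qed.

Lemma diag_upper_trig (R : pzRingType) (n : nat) (d : 'rV[R]_n) :
  diag_mx d \in @upper_trig R n.
Proof.
apply/upper_trigP=> i j lt_ji; rewrite mxE.
by case: eqP lt_ji => [->|//]; rewrite ltnn.
Qed.

Definition diag_upper (R : pzRingType) (n : nat) (d : 'rV[R]_n) :
  upper_mx R n := UpperMx (diag_upper_trig d).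

Lemma diag_upperE (R : pzRingType) (n : nat) (d : 'rV[R]_n) (i : 'I_n) :
  diag_upper d i i = d 0 i.
Proof. by rewrite mxE eqxx. Qed.

Lemma diag_upperX (R : pzRingType) (n : nat) (d : 'rV[R]_n) (k : nat) :
  diag_upper d ^+ k = diag_upper (\row_i (d 0 i ^+ k)).
Proof.
elim: k => [|k IHk].
  by apply: val_inj; apply/matrixP=> i j; rewrite expr0 !mxE expr0.
rewrite exprS IHk; apply: val_inj; rewrite /= -[LHS]/(diag_mx _ *m diag_mx _).
by rewrite mul_diag_mx; apply/matrixP=> i j; rewrite !mxE mulrnAr exprS.
Qed.

Lemma tri_comp_diag_upper (G : groupType) (R : pzRingType) (C : grading G R)
    (n : nat) (sigma : 'I_n -> G) (l : G) (d : 'rV[R]_n) :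
  (forall i, C (sigma i * l * (sigma i)^-1)%g (d 0 i)) ->
  tri_grading C sigma l (diag_upper d).
Proof.
move=> Cd i j; rewrite mxE.
by case: eqP => [<-|_]; rewrite ?mulr1n //; apply: gcomp0.
Qed.

Lemma tri_graded_nil_clean (m : nat) (G : groupType) (R : pzRingType)
    (C : grading G R) (n : nat) (sigma : 'I_n -> G) :
  (0 < m)%N -> graded_nil_clean m C ->
  graded_nil_clean m (tri_grading C sigma).
Proof.
move=> m_gt0 cleanC A [l CA].
have [f /all_and3[Cf potf nilf]] := fin_all_exists (fun i =>
  graded_nil_clean_same_degree m_gt0 cleanC (CA i i)).
pose F := diag_upper (\row_i f i).
have CF : tri_grading C sigma l F.
  by apply: tri_comp_diag_upper => i; rewrite mxE.
exists F, (A - F); split; last by rewrite addrC subrK.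
- by exists l.
- rewrite /potent diag_upperX; congr diag_upper.
  by apply/rowP=> i; rewrite !mxE potf.
- by exists l; apply: gcompB.
- apply: upper_nilpotent => i.
  have -> : (A - F) i i = A i i - f i by rewrite !mxE eqxx mulr1n.
  exact: nilf.
Qed.

Lemma graded_nil_clean_of_tri (m : nat) (G : groupType) (R : pzRingType)
    (C : grading G R) (n : nat) :
  (0 < n)%N -> graded_nil_clean m (tri_grading C (fun _ : 'I_n => 1%g)) ->
  graded_nil_clean m C.
Proof.
move=> n_gt0 cleanT x [g Cx]; pose i := Ordinal n_gt0.
have entry_hom A : homogeneous (tri_grading C (fun _ : 'I_n => 1%g)) A ->
    homogeneous C (A i i).
  by case=> l /(_ i i) CA; exists (1 * l * 1^-1)%g.
have [|F [B [homF potF homB [k Bk] def_x]]] := cleanT (diag_upper (const_mx x)).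
  exists g; apply: tri_comp_diag_upper => j.
  by rewrite mxE mul1g invg1 mulg1.
exists (F i i), (B i i); split; [exact: entry_hom | | exact: entry_hom | |].
- by rewrite /potent -upper_diagX potF.
- by exists k; rewrite -upper_diagX Bk mxE.
- by have := diag_upperE (const_mx x) i; rewrite def_x !mxE.
Qed.

Theorem theorem4p6 (m n : nat) (hm : (2 <= m)%N) (hn : (1 <= n)%N)
  (G : groupType) (hG : torsion_free (m - 1) G)
  (R : pzRingType) (C : grading G R)
  (hR : in_units ((m - 1)%:R : R)) :
  graded_nil_clean m C <->
  (forall sigma : 'I_n -> G, graded_nil_clean m (tri_grading C sigma)).
Proof.
split=> [cleanC sigma | cleanT].
  exact: tri_graded_nil_clean (ltnW hm) cleanC.
exact: graded_nil_clean_of_tri hn (cleanT _).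
Qed.
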